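(* Let $n\ge3$ be even and let $\mathbb{F}$ be an arbitrary field. Let $D_{2n}=\langle a,b\mid a^n=1=b^2,\ (ab)^2=1\rangle$, let $s,t$ be integers with $0\le s\le n-1$, $s\neq0,\frac n2$, $0\le t\le n-1$, and let $\sigma_1$ be the $\mathbb{F}$-linear extension to $\mathbb{F}D_{2n}$ of the group endomorphism of $D_{2n}$ given by $\sigma_1(a)=a^s$, $\sigma_1(b)=a^tb$. Denote by $m=|\sigma_1(a)|$ the order of $\sigma_1(a)$, $d=\frac nm$, and let $t\equiv j_0\pmod s$ for some $j_0\in\{0,1,\dots,s-1\}$. Then the following hold. (i) If $m$ is odd, then the dimension of $\mathrm{Inn}_{\sigma_1}(\mathbb{F}D_{2n})$ over $\mathbb{F}$ is $\frac12(3n-d)-2$ and a basis is $\{D_g\mid g\in S\}$, where $$S=\left\{a^k\;\middle|\;1\le k\le\tfrac n2-1\right\}\cup\bigcup_{u=j_0}^{j_0+\frac d2}\{a^{2si}a^ub\mid1\le i\le m-1\}\cup\bigcup_{u=j_0+1}^{j_0+\frac d2-1}\{a^{2si}a^{2j_0-u}b\mid0\le i\le m-1\}.$$ (ii) If $m$ is even, then the dimension of $\mathrm{Inn}_{\sigma_1}(\mathbb{F}D_{2n})$ over $\mathbb{F}$ is $\frac{3n}2-d-2$ and a basis is $\{D_g\mid g\in S'\}$, where $$S'=\left\{a^k\;\middle|\;1\le k\le\tfrac n2-1\right\}\cup\bigcup_{u=j_0}^{j_0+d}\{a^{2si}a^ub\mid1\le i\le m-1\}\cup\bigcup_{u=j_0+1}^{j_0+d-1}\{a^{si}a^{2j_0-u}b\mid0\le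 i\le m-1\}.$$
   Context: For a unital algebra endomorphism $\sigma$ of $\mathbb{F}D_{2n}$ and $\beta\in\mathbb{F}D_{2n}$, $D_\beta$ denotes the inner $\sigma$-derivation $D_\beta(\alpha)=\beta\sigma(\alpha)-\sigma(\alpha)\beta$ of $\mathbb{F}D_{2n}$, and $\mathrm{Inn}_\sigma(\mathbb{F}D_{2n})=\{D_\beta\mid\beta\in\mathbb{F}D_{2n}\}$, an $\mathbb{F}$-vector space under pointwise operations.
   Formalization: In (ii) the printed S' is linearly dependent (e.g. n=4, s=1, t=0 over Q: 5 elements, dimension 3); the formal S' lets i run only up to m/2-1 in both unions and uses a^{2si} in place of a^{si} in the second union. *)

(* Defs.v *)
From HB Require Import structures.
From mathcomp Require Import all_boot all_order all_algebra.
From mathcomp Require Import all_fingroup all_solvable all_field.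

Set Implicit Arguments.
Unset Strict Implicit.
Unset Printing Implicit Defensive.

Import GRing.Theory.
Local Open Scope ring_scope.

Section InnerDerivations.
Variables (F : fieldType) (A : falgType F) (sigma : {lrmorphism A -> A}).

Definition inn_der (beta alpha : A) : A :=
  beta * sigma alpha - sigma alpha * beta.

Fact inn_der_is_linear beta : linear (inn_der beta).
Proof.
move=> k x y; rewrite /inn_der linearP mulrDl mulrDr -scalerAr -scalerAl.
by rewrite scalerBr opprD addrACA.
Qed.
HB.instance Definition _ beta :=
  GRing.isLinear.Build F A A *:%R (inn_der beta) (inn_der_is_linear beta).

Definition inn_lfun (beta : A) : 'End(A) := linfun (inn_der beta).

Lemma inn_lfunE beta alpha :
  inn_lfun beta alpha = beta * sigma alpha - sigma alpha * beta.
Proof. by rewrite lfunE. Qed.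

Fact inn_lfun_is_linear : linear inn_lfun.
Proof.
move=> k x y; apply/lfunP=> z; rewrite add_lfunE scale_lfunE !inn_lfunE.
by rewrite mulrDl mulrDr -scalerAr -scalerAl scalerBr opprD addrACA.
Qed.
HB.instance Definition _ :=
  GRing.isLinear.Build F A 'End(A) *:%R inn_lfun inn_lfun_is_linear.

Definition Inn : {vspace 'End(A)} := limg (linfun inn_lfun).

Lemma InnP (f : 'End(A)) :
  reflect (exists beta, f = inn_lfun beta) (f \in Inn).
Proof.
apply: (iffP memv_imgP) => [[beta _ ->]|[beta ->]]; exists beta => //.
- by rewrite lfunE.
- exact: memvf.
- by rewrite lfunE.
Qed.

End InnerDerivations.

(* The group algebra of a finite group: functions from the group to the field
   under convolution. The type is an alias of {ffun gT -> F}, which already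
   carries the pointwise product in MathComp. *)
Definition galg (F : fieldType) (gT : finGroupType) : Type := {ffun gT -> F}.

Section GroupAlgebra.
Variables (F : fieldType) (gT : finGroupType).
Local Notation FG := (galg F gT).

HB.instance Definition _ := Vector.copy FG {ffun gT -> F^o}.

Implicit Types f g h : FG.

Definition gelt (x : gT) : FG := [ffun y => (y == x)%:R].
Definition galg_mul f g : FG := [ffun x => \sum_y f y * g (y^-1 * x)%g].

Let coefD f g x : (f + g) x = f x + g x. Proof. exact: ffunE. Qed.
Let coefZ (k : F) f x : (k *: f) x = k * f x. Proof. exact: ffunE. Qed.

Fact galg_mulA : associative galg_mul.
Proof.
move=> f g h; apply/ffunP=> x; rewrite !ffunE.
under eq_bigr do rewrite ffunE big_distrr /=.
under [RHS]eq_bigr do rewrite ffunE big_distrl /=.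
rewrite [RHS]exchange_big /=; apply: eq_bigr => y _.
rewrite [RHS](reindex_inj (mulgI y)) /=; apply: eq_bigr => z _.
by rewrite mulKg invMg -mulgA mulrA.
Qed.

Fact galg_mul1l : left_id (gelt 1%g) galg_mul.
Proof.
move=> f; apply/ffunP=> x; rewrite ffunE (bigD1 1%g) //= big1 => [|y ny1].
  by rewrite ffunE eqxx mul1r invg1 mul1g addr0.
by rewrite ffunE (negbTE ny1) mul0r.
Qed.

Fact galg_mul1r : right_id (gelt 1%g) galg_mul.
Proof.
move=> f; apply/ffunP=> x; rewrite ffunE (bigD1 x) //= big1 => [|y nyx].
  by rewrite ffunE mulVg eqxx mulr1 addr0.
by rewrite ffunE -eq_mulVg1 (negbTE nyx) mulr0.
Qed.

Fact galg_mulDl : left_distributive galg_mul +%R.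
Proof.
move=> f g h; apply/ffunP=> x; rewrite coefD !ffunE -big_split /=.
by apply: eq_bigr => y _; rewrite coefD mulrDl.
Qed.

Fact galg_mulDr : right_distributive galg_mul +%R.
Proof.
move=> f g h; apply/ffunP=> x; rewrite coefD !ffunE -big_split /=.
by apply: eq_bigr => y _; rewrite coefD mulrDr.
Qed.

Fact galg_1_neq0 : gelt 1%g != 0.
Proof. by apply/eqP=> /ffunP/(_ 1%g)/eqP; rewrite !ffunE eqxx oner_eq0. Qed.

HB.instance Definition _ := GRing.Zmodule_isNzRing.Build FG
  galg_mulA galg_mul1l galg_mul1r galg_mulDl galg_mulDr galg_1_neq0.

Fact galg_scaleAl (k : F) f g : k *: (f * g) = (k *: f) * g.
Proof.
apply/ffunP=> x; rewrite coefZ !ffunE big_distrr /=.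
by apply: eq_bigr => y _; rewrite coefZ mulrA.
Qed.
HB.instance Definition _ := GRing.Lmodule_isLalgebra.Build F FG galg_scaleAl.

Fact galg_scaleAr (k : F) f g : k *: (f * g) = f * (k *: g).
Proof.
apply/ffunP=> x; rewrite coefZ !ffunE big_distrr /=.
by apply: eq_bigr => y _; rewrite coefZ mulrCA.
Qed.
HB.instance Definition _ := GRing.Lalgebra_isAlgebra.Build F FG galg_scaleAr.
HB.instance Definition _ := Algebra_isFalgebra.Build F FG.

Lemma galg_mulE f g x : (f * g) x = \sum_y f y * g (y^-1 * x)%g.
Proof. exact: ffunE. Qed.

Lemma gelt1 : gelt 1%g = 1. Proof. by []. Qed.

Lemma geltM (x y : gT) : gelt (x * y)%g = gelt x * gelt y.
Proof.
apply/ffunP=> z; rewrite galg_mulE (bigD1 x) //= big1 => [|u nux].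
  by rewrite !ffunE eqxx mul1r addr0 (canF_eq (mulKVg x)).
by rewrite ffunE (negbTE nux) mul0r.
Qed.

Lemma galg_expand f : f = \sum_x f x *: gelt x.
Proof.
apply/ffunP=> y; rewrite sum_ffunE (bigD1 y) //= big1 => [|x nxy].
  by rewrite coefZ ffunE eqxx mulr1 addr0.
by rewrite coefZ ffunE eq_sym (negbTE nxy) mulr0.
Qed.

End GroupAlgebra.

Arguments gelt {F gT} x.

Section LinearExtension.
Variables (F : fieldType) (gT : finGroupType).
Variable phi : {morphism [set: gT] >-> gT}.
Local Notation FG := (galg F gT).

Definition galg_ext (f : FG) : FG := \sum_x f x *: gelt (phi x).

Fact galg_ext_is_linear : linear galg_ext.
Proof.
move=> k f g; rewrite /galg_ext scaler_sumr -big_split /=.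
by apply: eq_bigr => x _; rewrite scalerA -scalerDl !ffunE.
Qed.
HB.instance Definition _ :=
  GRing.isLinear.Build F FG FG *:%R galg_ext galg_ext_is_linear.

Lemma galg_ext_gelt x : galg_ext (gelt x) = gelt (phi x).
Proof.
rewrite /galg_ext (bigD1 x) //= big1 => [|y nyx].
  by rewrite ffunE eqxx scale1r addr0.
by rewrite ffunE (negbTE nyx) scale0r.
Qed.

Fact galg_ext_is_monoid_morphism : monoid_morphism galg_ext.
Proof.
split=> [|f g]; first by rewrite -gelt1 galg_ext_gelt morph1.
rewrite [f]galg_expand [g]galg_expand mulr_suml !linear_sum mulr_suml.
apply: eq_bigr => x _; rewrite !mulr_sumr linear_sum; apply: eq_bigr => y _.
rewrite -scalerAl -scalerAr !linearZ /= -geltM !galg_ext_gelt.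
by rewrite morphM ?inE // geltM -scalerAl -scalerAr.
Qed.
HB.instance Definition _ := GRing.isMonoidMorphism.Build FG FG galg_ext
  galg_ext_is_monoid_morphism.

End LinearExtension.

Arguments galg_ext F {gT} phi f.

(* The group gT is <a, b | a^n = b^2 = (ab)^2 = 1>, with a and b the two
   distinguished generators. *)
Definition dihedral_presentation (gT : finGroupType) (n : nat) (a b : gT) :=
  ([/\ [set: gT] \isog Grp (x : y : x ^+ n, y ^+ 2, (x * y) ^+ 2),
      <<[set a; b]>> = [set: gT]
    & [/\ a ^+ n = 1, b ^+ 2 = 1 & (a * b) ^+ 2 = 1]])%g.

Section BasisSets.
Variables (gT : finGroupType) (a b : gT) (n s j0 m d : nat).
Local Open Scope nat_scope.
Local Open Scope group_scope.

Definition rot_part : {set gT} := [set a ^+ val k | k : 'I_(n./2) & 0 < k].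

(* Since 2 j0 - u may be negative, a^(2 j0 - u) is written
   a ^+ (2 * j0) * a ^- u. *)
Definition basis_odd : {set gT} :=
  rot_part
  :|: \bigcup_(j0 <= u < (j0 + d./2).+1)
        [set a ^+ (2 * s * i) * a ^+ u * b | i : 'I_m & 0 < i]
  :|: \bigcup_(j0.+1 <= u < j0 + d./2)
        [set a ^+ (2 * s * i) * (a ^+ (2 * j0) * a ^- u) * b | i : 'I_m].

(* For m even, a ^+ (2 * s) has order m / 2, so i runs below m / 2 in both
   unions. The source prints S' with i <= m - 1 in both unions and with
   a^(s i) in the second one. As printed, S' contains whole orbits of
   reflections under conjugation by a^s and a^t b, so that {D_g | g in S'} is
   linearly dependent and has more elements than the stated dimension. *)
Definition basis_even : {set gT} :=
  rot_part
  :|: \bigcup_(j0 <= u < (j0 + d).+1)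
        [set a ^+ (2 * s * i) * a ^+ u * b | i : 'I_(m./2) & 0 < i]
  :|: \bigcup_(j0.+1 <= u < j0 + d)
        [set a ^+ (2 * s * i) * (a ^+ (2 * j0) * a ^- u) * b | i : 'I_(m./2)].

End BasisSets.

(* Main.v *)
Require Import Defs.
From HB Require Import structures.
From mathcomp Require Import all_boot all_order all_algebra.
From mathcomp Require Import all_fingroup all_solvable all_field.
From mathcomp Require Import zify lra.

Set Implicit Arguments.
Unset Strict Implicit.
Unset Printing Implicit Defensive.

Import GRing.Theory.
Local Open Scope ring_scope.

(** The derivation D_beta vanishes exactly when beta commutes with sigma(g) for
    every group element g, that is, when the coefficient function of beta is
    constant on the orbits of D_2n acting on itself by conjugation through phi.
    Inn is therefore the quotient of the group algebra by the functions
    constant on orbits.  If the complement of S meets every orbit in exactly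
    one point, then the span of S is a complement of these functions: a
    function supported in S and constant on orbits vanishes, and subtracting
    from any function the orbit-constant function with the same values off S
    leaves a function supported in S.  Hence {D_g | g in S} is a basis of Inn
    (basis_of_transversal).

    The rest is a computation of orbits.  Let the order of a^(2s) be M and
    n = 2cM, so that a^(2s) generates the same subgroup as a^(2c).  Conjugation
    by phi(a) = a^s fixes rotations and sends a^k b to a^(k-2s) b; conjugation
    by phi(b) = a^t b sends a^k to a^(-k) and a^k b to a^(2t-k) b.  As t and j0
    agree modulo s, and 2c divides 2s, the orbits are the sets {a^k, a^(-k)}
    and the sets of reflections a^k b whose k lies in a class of integers
    modulo 2c up to the symmetry k -> 2 j0 - k.  The rotations 1 and a^k with
    n/2 <= k < n, together with the reflections a^u b with j0 <= u <= j0 + c,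
    contain one point of every orbit, and the set of the theorem is their
    complement; there are n/2 + c + 2 of them among the 2n group elements.

    For m odd, a^(2s) has order M = m, so c = d/2; for m even it has order
    M = m/2, so c = d.  Both parts are then Inn_dihedral. *)

(** * Coefficients in the group algebra *)

Section GroupAlgebraVectors.
Variables (F : fieldType) (gT : finGroupType).
Local Notation FG := (galg F gT).

Lemma mul_gelt_l (f : FG) (y x : gT) : (gelt y * f) x = f (y^-1 * x)%g.
Proof.
rewrite galg_mulE (bigD1 y) //= big1 => [|z /negPf nzy].
  by rewrite ffunE eqxx mul1r addr0.
by rewrite ffunE nzy mul0r.
Qed.

Lemma mul_gelt_r (f : FG) (y x : gT) : (f * gelt y) x = f (x * y^-1)%g.
Proof.
rewrite galg_mulE (bigD1 (x * y^-1)%g) //= big1 => [|z nz].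
  by rewrite ffunE invMg invgK mulgKV eqxx mulr1 addr0.
rewrite ffunE; case: eqP => [e|]; last by rewrite mulr0.
by case/eqP: nz; rewrite -e invMg invgK mulKVg.
Qed.

Definition gelt_seq (S : {set gT}) : seq FG := [seq gelt x | x <- enum S].

Lemma size_gelt_seq S : size (gelt_seq S) = size (enum S).
Proof. exact: size_map. Qed.

Lemma span_gelt (S : {set gT}) (f : FG) :
  reflect (forall x, x \notin S -> f x = 0) (f \in <<gelt_seq S>>%VS).
Proof.
apply: (iffP idP) => [/(@coord_span _ _ _ (in_tuple _)) -> x nSx | f0].
  rewrite sum_ffunE big1 // => i _.
  rewrite ffunE /= (nth_map 1%g) -?size_gelt_seq //.
  rewrite ffunE; case: eqP => [ex|]; last by rewrite scaler0.
  by case/negP: nSx; rewrite ex -mem_enum mem_nth // -size_gelt_seq.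
rewrite [f]galg_expand rpred_sum // => x _.
have [Sx|/f0->] := boolP (x \in S); last by rewrite scale0r mem0v.
by apply/rpredZ/memv_span/map_f; rewrite mem_enum.
Qed.

Lemma free_gelt (S : {set gT}) : free (gelt_seq S).
Proof.
apply/(@freeP _ _ _ (in_tuple _)) => k k0 i.
have lti (j : 'I_(size (gelt_seq S))) : (j < size (enum S))%N.
  by rewrite -size_gelt_seq.
have /ffunP/(_ (nth 1%g (enum S) i)) := k0.
rewrite sum_ffunE (bigD1 i) //= big1 => [|j nji].
  rewrite !ffunE /= (nth_map 1%g) // ffunE eqxx addr0 => <-.
  by rewrite [RHS]mulr1.
rewrite ffunE (nth_map 1%g) // ffunE nth_uniq ?enum_uniq //.
by rewrite eq_sym (inj_eq val_inj) (negPf nji) scaler0.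
Qed.

End GroupAlgebraVectors.

(** * Inner derivations and transversals of twisted conjugation orbits *)

Section TransversalBasis.
Variables (F : fieldType) (gT : finGroupType).
Variable phi : {morphism [set: gT] >-> gT}.
Local Notation FG := (galg F gT).
Local Notation sigma := (galg_ext F phi : {lrmorphism FG -> FG}).

(** By linearity, beta is in the kernel if and only if it commutes with each
    phi h; comparing coefficients turns this into invariance under conjugation
    by phi h. *)
Lemma inn_lfun_eq0 (f : FG) :
  inn_lfun sigma f = 0 <-> forall h x, f (x ^ phi h)%g = f x.
Proof.
split=> [f0 h x | fJ].
  have := inn_lfunE sigma f (gelt h); rewrite f0 lfunE /= galg_ext_gelt.
  move/esym/subr0_eq/ffunP/(_ (x * phi h)%g).
  by rewrite mul_gelt_l mul_gelt_r mulgK -conjgE => ->.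
apply/lfunP=> z; rewrite [z]galg_expand !linear_sum; apply: eq_bigr => h _.
rewrite !linearZ /=; congr (_ *: _); rewrite inn_lfunE lfunE /= galg_ext_gelt.
apply/eqP; rewrite subr_eq0; apply/eqP/ffunP=> x.
by rewrite mul_gelt_l mul_gelt_r -(fJ h) conjgE mulgKV.
Qed.

Variable S : {set gT}.
(* The complement of S is a transversal of the orbits of conjugation by the
   image of phi. *)
Hypothesis S_meet : forall x, exists h, (x ^ phi h)%g \notin S.
Hypothesis S_uniq : forall x h,
  x \notin S -> (x ^ phi h)%g \notin S -> (x ^ phi h)%g = x.

Let V : {vspace FG} := <<gelt_seq F S>>%VS.
Let L : 'Hom(FG, 'End(FG)) := linfun (inn_lfun sigma).

Let LE f : L f = inn_lfun sigma f. Proof. by rewrite lfunE. Qed.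

Let V_cap_ker : (V :&: lker L)%VS = 0%VS.
Proof.
apply/eqP; rewrite -subv0; apply/subvP=> f.
rewrite memv_cap memv_ker LE memv0 => /andP[/span_gelt fS /eqP/inn_lfun_eq0 fJ].
by apply/eqP/ffunP=> x; have [h /fS] := S_meet x; rewrite fJ ffunE.
Qed.

Let V_add_ker : (V + lker L)%VS = fullv.
Proof.
apply/eqP; rewrite eqEsubv subvf /=; apply/subvP=> f _.
(* r x is the representative of the orbit of x. *)
pose hh x := xchoose (S_meet x); pose r x := (x ^ phi (hh x))%g.
pose g : FG := [ffun x => f (r x)].
have rJ h x : r (x ^ phi h)%g = r x.
  have := @S_uniq (r x) ((hh x)^-1 * h * hh (x ^ phi h))%g.
  move/(_ (xchooseP (S_meet x))).
  rewrite /r !morphM ?inE // morphV ?inE // !conjgM conjgK.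
  by move=> -> //; rewrite -/(r _) (xchooseP (S_meet _)).
have rT x : x \notin S -> r x = x.
  by move=> nSx; rewrite /r S_uniq // (xchooseP (S_meet x)).
have ->: f = (f - g) + g by rewrite subrK.
apply: memv_add.
  by apply/span_gelt => x nSx; rewrite !ffunE rT // subrr.
by rewrite memv_ker LE; apply/eqP/inn_lfun_eq0=> h x; rewrite !ffunE rJ.
Qed.

(** The span of S and the kernel of beta |-> D_beta are complementary, so this
    map sends the basis S of the span to a basis of its image. *)
Lemma basis_of_transversal :
  basis_of (Inn sigma) [seq inn_lfun sigma (gelt g) | g <- enum S].
Proof.
have: basis_of (L @: V) (map L (gelt_seq F S)).
  by apply: limg_basis_of => //; rewrite /basis_of eqxx free_gelt.
have ->: (L @: V = Inn sigma)%VS.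
  rewrite /Inn -V_add_ker limgD; apply/esym/addv_idPl.
  by rewrite (subv_trans _ (sub0v _)) // subv0 -lkerE.
by rewrite -map_comp; under eq_map do rewrite /= LE.
Qed.

Lemma dim_Inn_transversal : \dim (Inn sigma) = #|S|.
Proof.
have := @size_basis _ _ _ _ (in_tuple _) basis_of_transversal.
by rewrite size_map -cardE.
Qed.

End TransversalBasis.

(** * Normal forms and conjugation in the dihedral group *)

Section Dihedral.
Local Open Scope nat_scope.
Local Open Scope group_scope.

(** A presentation bounds the order from above only; the lower bound comes from
    a model, the dihedral group of order 2n, which satisfies the relations and
    is thus a quotient of the presented group. *)
Lemma dihedral_presentation_card (gT : finGroupType) n (a b : gT) :
  1 < n -> dihedral_presentation n a b -> n.*2 <= #|gT|.
Proof.
move=> n_gt1 [isoG _ _].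
rewrite -cardsT -(card_dihedral n_gt1) dvdn_leq ?cardG_gt0 // card_homg //.
have /existsP[[x y] /=] := isoGrp_hom (Grp_dihedral n_gt1).
case/eqP=> defD xn y2 xJy; rewrite isoG; apply/existsP; exists (x, y).
rewrite /= !xpair_eqE defD xn y2 !eqxx /= expgS expg1.
have yV: y^-1 = y by apply/eqP; rewrite eq_invg_mul -(expgS y 1) y2.
have ->: x * y * (x * y) = x * x ^ y by rewrite conjgE yV !mulgA.
by rewrite xJy mulgV.
Qed.

Variables (gT : finGroupType) (n : nat) (a b : gT).
Hypotheses (n_gt1 : 1 < n) (D2n : dihedral_presentation n a b).

Lemma dih_bV : b^-1 = b.
Proof.
by case: D2n => _ _ [_ b2 _]; apply/eqP; rewrite eq_invg_mul -(expgS b 1) b2.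
Qed.

Lemma dih_b_rot k : b * a ^+ k = a ^- k * b.
Proof.
case: D2n => _ _ [_ _ ab2].
have aJb: a ^ b = a^-1.
  rewrite conjgE dih_bV; apply/eqP; rewrite eq_sym eq_invg_mul.
  by rewrite -ab2 expgS expg1 !mulgA.
by rewrite conjgCV dih_bV conjXg aJb expgVn.
Qed.

Lemma dih_gen : <[a]> * <[b]> = [set: gT].
Proof.
case: D2n => _ <- _; rewrite -norm_joinEr ?joing_idl ?joing_idr //.
rewrite norms_cycle conjgE -(expg1 a) mulgA dih_bV dih_b_rot.
by rewrite expg1 -{2}dih_bV mulgK groupV cycle_id.
Qed.

Lemma dih_card_le : #|gT| <= #[a] * 2.
Proof.
case: D2n => _ _ [_ b2 _]; rewrite -cardsT -dih_gen.
rewrite (@leq_trans (#[a] * #[b])%N) //.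
  by rewrite dvdn_leq ?muln_gt0 ?order_gt0 // dvdn_cardMg.
by rewrite leq_mul2l dvdn_leq ?orbT // order_dvdn b2.
Qed.

(** The order of the group is at least 2n, while a has order at most n and
    the cosets of 1 and b cover the group; so every inequality is an
    equality. *)
Lemma dih_order : #[a] = n /\ b \notin <[a]>.
Proof.
have n_gt0 := ltnW n_gt1; have le2n := dihedral_presentation_card n_gt1 D2n.
have := dih_card_le; have [_ _ [an _ _]] := D2n.
have le_an: #[a] <= n by rewrite dvdn_leq // order_dvdn an.
split; first by lia.
apply/negP=> b_a; move: le2n.
by rewrite -cardsT -dih_gen mulGSid ?cycle_subG // -orderE; lia.
Qed.

Lemma dih_card : #|gT| = n.*2.
Proof.
have := dih_card_le; have := dihedral_presentation_card n_gt1 D2n.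
by rewrite dih_order.1; lia.
Qed.

Lemma dih_normal_form x : exists2 k, k < n & x = a ^+ k \/ x = a ^+ k * b.
Proof.
case: (D2n) => _ _ [_ b2 _].
have: x \in <[a]> * <[b]> by rewrite dih_gen inE.
case/mulsgP=> _ _ /cyclePmin[k ltk ->] /cycleP[j ->] ->.
rewrite dih_order.1 in ltk; exists k => //.
rewrite -(odd_double_half j) expgD -muln2 mulnC expgM b2 expg1n mulg1.
by case: (odd j); [right | left; rewrite mulg1].
Qed.

Lemma dih_rot_neq_refl g h : g \in <[a]> -> h \in <[a]> -> g <> h * b.
Proof.
move=> ga ha eg; case/negP: dih_order.2.
by rewrite -(mulKg h b) -eg groupM ?groupV.
Qed.

Lemma dih_eqX i k : a ^+ i = a ^+ k <-> i = k %[mod n].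
Proof.
rewrite -dih_order.1; split=> /eqP; first by rewrite eq_expg_mod_order => /eqP.
by rewrite -eq_expg_mod_order => /eqP.
Qed.

Lemma dih_rotV k : k <= n -> a ^- k = a ^+ (n - k)%N.
Proof.
case: D2n => _ _ [an _ _] le_kn.
by apply/eqP; rewrite eq_invg_mul -expgD subnKC // an.
Qed.

Lemma dih_rotJ k : (a ^+ k) ^ b = a ^- k.
Proof. by rewrite conjgE dih_bV mulgA dih_b_rot -{2}dih_bV mulgK. Qed.

Lemma dih_rotJ_refl k e : (a ^+ k) ^ (a ^+ e * b) = a ^- k.
Proof.
by rewrite conjgM (conjgE _ (a ^+ e)) -expgD addnC expgD mulKg dih_rotJ.
Qed.

Lemma dih_reflJ k e : (a ^+ k * b) ^ (a ^+ e) = a ^- e * a ^+ k * a ^- e * b.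
Proof. by rewrite conjgE -!mulgA dih_b_rot. Qed.

(** Moving the negative exponent of l = k - 2e to the other side keeps the
    exponents natural numbers; likewise for l = 2e - k in the next lemma. *)
Lemma dih_reflJ_rot k e l :
  (a ^+ k * b) ^ (a ^+ e) = a ^+ l * b <-> a ^+ k = a ^+ (l + 2 * e)%N.
Proof.
rewrite dih_reflJ mul2n -addnn addnCA addnA !expgD; split=> [/mulIg <- | ->].
  by rewrite -!mulgA mulVg mulg1 mulKVg.
by rewrite !mulgA mulgK mulVg mul1g.
Qed.

Lemma dih_reflJ_refl k e l :
  (a ^+ k * b) ^ (a ^+ e * b) = a ^+ l * b <-> a ^+ (k + l)%N = a ^+ (2 * e)%N.
Proof.
have ->: (a ^+ k * b) ^ (a ^+ e * b) = a ^+ e * a ^- k * a ^+ e * b.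
  rewrite conjgM dih_reflJ !conjMg conjVg !dih_rotJ (conjgE b b) mulKg.
  by rewrite !invgK.
have cX i j : a ^+ i * a ^- j = a ^- j * a ^+ i.
  by apply: commuteV; apply: commuteX2.
rewrite mul2n -addnn !expgD cX -(mulgA (a ^- k)); split=> [/mulIg <- | <-].
  by rewrite mulKVg.
by rewrite mulKg.
Qed.

Lemma dih_reflJ_is_refl k x : exists l, (a ^+ k * b) ^ x = a ^+ l * b.
Proof.
have bb (y : gT) : y * b * b = y by rewrite -{2}dih_bV mulgK.
suff: (a ^+ k * b) ^ x * b \in <[a]>.
  by case/cycleP=> l el; exists l; rewrite -el bb.
have [e _ [] ->] := dih_normal_form x; rewrite ?conjgM dih_reflJ.
  by rewrite bb !groupM ?groupV ?mem_cycle.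
rewrite !conjMg conjVg !dih_rotJ (conjgE b b) mulKg bb.
by rewrite !groupM ?groupV ?mem_cycle.
Qed.

End Dihedral.

(** * The reflections and rotations left out of the basis form a transversal *)

Section DihedralTransversal.
Local Open Scope nat_scope.
Local Open Scope group_scope.

Lemma bigcup_nat_mem (I : finType) m p (A : nat -> {set I}) x :
  reflect (exists2 u, m <= u < p & x \in A u) (x \in \bigcup_(m <= u < p) A u).
Proof.
have ->: (x \in \bigcup_(m <= u < p) A u)
           = has (fun u => x \in A u) (index_iota m p).
  elim: (index_iota m p) => [|u r IHr]; first by rewrite big_nil inE.
  by rewrite big_cons inE IHr.
apply: (iffP hasP) => -[u ru xu]; exists u => //.
  by rewrite mem_index_iota in ru.
by rewrite mem_index_iota.
Qed.

Variables (gT : finGroupType) (n : nat) (a b : gT).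
Hypotheses (n_gt1 : 1 < n) (D2n : dihedral_presentation n a b).
Variables (s j0 M c : nat).
Hypotheses (oas : #[a ^+ (2 * s)%N] = M) (n_eq : n = (M * (2 * c))%N).

(** The common form of the bases for m odd (M = m, c = d/2) and for m even
    (M = m/2, c = d). *)
Definition dih_basis : {set gT} :=
  rot_part a n
  :|: \bigcup_(j0 <= u < (j0 + c).+1)
        [set a ^+ (2 * s * i) * a ^+ u * b | i : 'I_M & 0 < i]
  :|: \bigcup_(j0.+1 <= u < j0 + c)
        [set a ^+ (2 * s * i) * (a ^+ (2 * j0) * a ^- u) * b | i : 'I_M].

Let rot_refl i k : a ^+ i <> a ^+ k * b.
Proof. by apply: (dih_rot_neq_refl n_gt1 D2n); rewrite mem_cycle. Qed.
Let eqX := dih_eqX n_gt1 D2n.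

Lemma dih_c_gt0 : 0 < c.
Proof. by have := ltnW n_gt1; rewrite n_eq !muln_gt0 => /and3P[]. Qed.

Lemma dih_M_gt0 : 0 < M.
Proof. by have := ltnW n_gt1; rewrite n_eq !muln_gt0 => /and3P[]. Qed.

Lemma dih_half : n./2 = (M * c)%N.
Proof. by rewrite n_eq mulnCA mul2n doubleK. Qed.

Lemma dih_gcd : (2 * c)%N = gcdn n (2 * s).
Proof.
have := oas; rewrite orderXgcd (dih_order n_gt1 D2n).1 => eM.
apply/eqP; rewrite -(eqn_pmul2l dih_M_gt0) -n_eq -{1}eM.
by rewrite divnK ?dvdn_gcdl.
Qed.

Lemma dih_dvd_n : 2 * c %| n. Proof. by rewrite n_eq dvdn_mull. Qed.
Lemma dih_dvd_s : 2 * c %| 2 * s. Proof. by rewrite dih_gcd dvdn_gcdr. Qed.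

Lemma dih_coset_mod k u i :
  a ^+ k = a ^+ (2 * s * i)%N * a ^+ u -> k = u %[mod 2 * c].
Proof.
rewrite -expgD => /eqX /(congr1 (modn^~ (2 * c)%N)).
rewrite !modn_dvdm ?dih_dvd_n // => ->.
by have /dvdnP[q ->] := dih_dvd_s; rewrite mulnAC modnMDl.
Qed.

(** Conversely, a^(2s) and a^(2c) have the same order in the cyclic group of
    rotations, so they generate the same subgroup. *)
Lemma dih_mod_coset k u : k = u %[mod 2 * c] ->
  exists2 i, i < M & a ^+ k = a ^+ (2 * s * i)%N * a ^+ u.
Proof.
move=> eku; have oa := (dih_order n_gt1 D2n).1; have c0 := dih_c_gt0.
have defC: <[a ^+ (2 * c)%N]> = <[a ^+ (2 * s)%N]>.
  apply/eqP; rewrite (eq_subG_cyclic (cycle_cyclic a)) ?cycleX //.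
  by rewrite -!orderE oas orderXdiv oa ?dih_dvd_n // n_eq mulnK ?muln_gt0.
(* Adding n * u makes the difference of exponents a natural number. *)
have le_u: u <= k + n * u.
  by rewrite (leq_trans _ (leq_addl _ _)) // leq_pmull // ltnW.
have /dvdnP[q eq]: (2 * c %| k + n * u - u)%N.
  rewrite -eqn_mod_dvd // addnC; have /dvdnP[p ->] := dih_dvd_n.
  by rewrite mulnAC modnMDl eku.
have: a ^+ (2 * c * q)%N \in <[a ^+ (2 * s)%N]>.
  by rewrite -defC expgM mem_cycle.
case/cyclePmin=> i; rewrite oas -expgM => lti ei; exists i => //.
rewrite -ei -expgD mulnC -eq subnK //; apply/eqX.
by rewrite addnC mulnC modnMDl.
Qed.

Lemma dih_residue k : exists2 r, r < 2 * c & k = j0 + r %[mod 2 * c].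
Proof.
have c0 := dih_c_gt0; exists ((k + (2 * c).-1 * j0) %% (2 * c))%N.
  by rewrite ltn_mod; lia.
have ->: (j0 + (k + (2 * c).-1 * j0) %% (2 * c) =
          (k + (2 * c).-1 * j0) %% (2 * c) + j0)%N by rewrite addnC.
rewrite modnDml -addnA -mulSnr prednK; last by lia.
by rewrite (addnC k) (mulnC _ j0) modnMDl.
Qed.

Lemma rot_in_basis k : k < n -> (a ^+ k \in dih_basis) = (0 < k < n./2).
Proof.
move=> ltk; rewrite !in_setU.
apply/idP/andP => [/orP[/orP[/imsetP[i i0 /eqX ei]|]|]| [k0 lt2]].
- rewrite inE in i0.
  have lti: i < n by rewrite (leq_trans (ltn_ord i)) // -divn2 leq_div.
  by move: ei; rewrite !modn_small // => ->; split=> //; apply: ltn_ord.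
- by case/bigcup_nat_mem=> u _ /imsetP[i _]; rewrite -expgD => /rot_refl.
- case/bigcup_nat_mem=> u _ /imsetP[i _] e.
  exfalso; apply: (dih_rot_neq_refl n_gt1 D2n) e.
    exact: mem_cycle.
  by rewrite !groupM ?groupV ?mem_cycle.
- apply/orP; left; apply/orP; left.
  by apply/imsetP; exists (Ordinal lt2); rewrite ?inE.
Qed.

(** Write k = j0 + r modulo 2c with r < 2c.  If r <= c, then a^k b lies in the
    family of u = j0 + r, whose only omitted member is the one with i = 0.  If
    r > c, then the mirror image u = j0 + 2c - r lies strictly between j0 and
    j0 + c, and a^k b is in its family, from which nothing is omitted. *)
Lemma refl_notin_basis k :
  a ^+ k * b \notin dih_basis <-> exists2 r, r <= c & a ^+ k = a ^+ (j0 + r).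
Proof.
have c0 := dih_c_gt0; split=> [nBk | [r le_rc ->]].
  have [r lt_r ekr] := dih_residue k.
  have [le_rc | lt_cr] := leqP r c.
    have /dih_mod_coset[[|i] lti ei] := ekr.
      by exists r => //; rewrite ei muln0 mul1g.
    case/negP: nBk; rewrite !in_setU; apply/orP; left; apply/orP; right.
    apply/bigcup_nat_mem; exists (j0 + r)%N; first by lia.
    by apply/imsetP; exists (Ordinal lti); rewrite ?inE //= -ei.
  have: (k + (j0 + (2 * c - r)) = 2 * j0 %[mod 2 * c])%N.
    rewrite -modnDml ekr modnDml.
    have ->: (j0 + r + (j0 + (2 * c - r)) = 2 * j0 + 2 * c)%N by lia.
    by rewrite modnDr.
  case/dih_mod_coset=> i lti ei; case/negP: nBk; rewrite !in_setU.
  apply/orP; right; apply/bigcup_nat_mem; exists (j0 + (2 * c - r))%N.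
    by lia.
  apply/imsetP; exists (Ordinal lti); rewrite ?inE //=; congr (_ * b).
  by rewrite mulgA -ei expgD mulgK.
rewrite !in_setU !negb_or -andbA; apply/and3P; split.
- by apply/imsetP=> -[i _ /esym/rot_refl].
- apply/bigcup_nat_mem=> -[u le_u /imsetP[i i0 /mulIg e]].
  have /eqP: j0 + r = u %[mod 2 * c] by exact: dih_coset_mod e.
  rewrite -(subnKC (_ : j0 <= u)) ?eqn_modDl ?modn_small; try lia.
  move/eqP=> er; move: e; rewrite er subnKC; last by lia.
  rewrite -[LHS]mul1g expgM => /mulIg/esym/eqP; rewrite -order_dvdn oas.
  by rewrite inE in i0; rewrite gtnNdvd.
- apply/bigcup_nat_mem=> -[u lt_u /imsetP[i _ /mulIg e]].
  have: (j0 + r + u = 2 * j0 %[mod 2 * c])%N.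
    by apply: (@dih_coset_mod _ _ i); rewrite expgD e !mulgA mulgKV.
  move/eqP.
  have ->: (j0 + r + u = 2 * j0 + (r + (u - j0)))%N by lia.
  rewrite -{2}(addn0 (2 * j0)%N) eqn_modDl mod0n modn_small; lia.
Qed.

Lemma dih_basis_card : (#|dih_basis| + (M * c + c + 2) = n.*2)%N.
Proof.
have n2 := dih_half.
have c0 := dih_c_gt0; have M0 := dih_M_gt0.
have Mc0: 0 < M * c by rewrite muln_gt0 M0.
have nE: n = (2 * (M * c))%N by rewrite n_eq mulnCA.
(* The inverses of the rotations a^r with r <= n/2 are 1 and the a^k with
   n/2 <= k < n. *)
pose T1 := [set a ^- (r : nat) | r : 'I_(M * c).+1].
pose T2 := [set a ^+ (j0 + r) * b | r : 'I_c.+1].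
have oT1: #|T1| = (M * c).+1.
  rewrite card_imset ?card_ord // => i j /invg_inj/eqX.
  have := ltn_ord i; have := ltn_ord j.
  by move=> lt_j lt_i; rewrite !modn_small; [move/val_inj | lia | lia].
have oT2: #|T2| = c.+1.
  rewrite card_imset ?card_ord // => i j /mulIg/eqX/eqP.
  have := ltn_ord i; have := ltn_ord j; have: c <= M * c by rewrite leq_pmull.
  move=> le_c lt_j lt_i; rewrite eqn_modDl !modn_small; try lia.
  by move/eqP/val_inj.
have T1d: [disjoint T1 & T2].
  rewrite -setI_eq0; apply/eqP/setP=> x; rewrite !inE; apply/andP.
  case=> /imsetP[i _ ->] /imsetP[r _].
  by apply: (dih_rot_neq_refl n_gt1 D2n); rewrite ?groupV mem_cycle.
have: ~: dih_basis = T1 :|: T2.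
  apply/setP=> x; rewrite in_setC [RHS]in_setU.
  have [k ltk [] ->] := dih_normal_form n_gt1 D2n x.
    rewrite rot_in_basis //; apply/idP/orP => [nk | [|]].
    - left; have [-> | k0] := posnP k; apply/imsetP.
        by exists ord0; rewrite ?invg1.
      have lt: n - k < (M * c).+1 by lia.
      exists (Ordinal lt); first by rewrite inE.
      by rewrite [RHS](dih_rotV D2n (leq_subr _ _)) subKn // ltnW.
    - case/imsetP=> r _; have := ltn_ord r; rewrite ltnS => le_r.
      rewrite (dih_rotV D2n); last by lia.
      have [-> /eqX | r0 /eqX] := posnP r.
        by rewrite subn0 modnn modn_small // => ->.
      by rewrite !modn_small //; lia.
    - by case/imsetP=> i _ /rot_refl.
  apply/idP/orP=> [/refl_notin_basis[r le_r ->] | [|]].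
  - by right; apply/imsetP; exists (inord r); rewrite ?inordK.
  - case/imsetP=> i _ /esym e; exfalso.
    by apply: (dih_rot_neq_refl n_gt1 D2n) e; rewrite ?groupV mem_cycle.
  - case/imsetP=> r _ /mulIg ek; apply/refl_notin_basis; exists (r : nat) => //.
    by rewrite -ltnS ltn_ord.
move=> defT; rewrite -(dih_card n_gt1 D2n) -(cardsC dih_basis) defT.
by rewrite (cardsU T1) (disjoint_setI0 T1d) cards0 oT1 oT2; lia.
Qed.

Variables (t : nat) (phi : {morphism [set: gT] >-> gT}).
Hypotheses (phi_a : phi a = a ^+ s) (phi_b : phi b = a ^+ t * b).
Hypothesis t_mod : t = j0 %[mod s].

Lemma dih_phiX i : phi (a ^+ i) = a ^+ (s * i)%N.
Proof. by rewrite morphX ?inE // phi_a expgM. Qed.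

Lemma dih_phiXb i : phi (a ^+ i * b) = a ^+ (s * i + t)%N * b.
Proof. by rewrite morphM ?inE // dih_phiX phi_b mulgA expgD. Qed.

Lemma dih_double_t : (2 * t = 2 * j0 %[mod 2 * c])%N.
Proof.
have e: (2 * t = 2 * j0 %[mod 2 * s])%N by rewrite -!muln_modr t_mod.
by rewrite -(modn_dvdm _ dih_dvd_s) e modn_dvdm ?dih_dvd_s.
Qed.

(** A rotation a^k with k < n/2 is inverted by phi(b).  For a reflection,
    phi(a^i) reaches a^(j0 + r) b when the residue r of k - j0 modulo 2c is at
    most c, and phi(a^i b) reaches its mirror image a^(j0 + 2c - r) b
    otherwise. *)
Lemma dih_basis_meet x : exists h, x ^ phi h \notin dih_basis.
Proof.
have n2 := dih_half.
have [k ltk [] ->] := dih_normal_form n_gt1 D2n x.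
  have [lt2 | ge2] := boolP (0 < k < n./2); last first.
    by exists 1; rewrite morph1 conjg1 rot_in_basis.
  exists b; rewrite phi_b (dih_rotJ_refl D2n).
  by rewrite (dih_rotV D2n (ltnW ltk)) rot_in_basis; lia.
have [r lt_r ekr] := dih_residue k.
have [le_rc | lt_cr] := leqP r c.
  have /dih_mod_coset[i lti ei] := ekr; exists (a ^+ i); rewrite dih_phiX.
  have ->: (a ^+ k * b) ^ a ^+ (s * i) = a ^+ (j0 + r) * b.
    by apply/(dih_reflJ_rot D2n); rewrite ei -expgD addnC mulnA.
  by apply/refl_notin_basis; exists r.
pose l := (j0 + (2 * c - r))%N.
have: (k + l = 2 * t %[mod 2 * c])%N.
  rewrite dih_double_t -modnDml ekr modnDml /l.
  have ->: (j0 + r + (j0 + (2 * c - r)) = 2 * j0 + 2 * c)%N by lia.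
  by rewrite modnDr.
case/dih_mod_coset=> i lti ei; exists (a ^+ i * b); rewrite dih_phiXb.
have ->: (a ^+ k * b) ^ (a ^+ (s * i + t) * b) = a ^+ l * b.
  by apply/(dih_reflJ_refl D2n); rewrite ei -expgD mulnDr mulnA.
by apply/refl_notin_basis; exists (2 * c - r)%N => //; lia.
Qed.

(** For reflections a^(j0 + r) b and a^(j0 + r') b with r, r' <= c, conjugacy by
    phi(a^i) gives r = r' modulo 2c, and conjugacy by phi(a^i b) gives
    r + r' = 0 modulo 2c; the latter forces r = r' = 0 or r = r' = c, the two
    fixed points of the symmetry. *)
Lemma dih_basis_uniq x h :
  x \notin dih_basis -> x ^ phi h \notin dih_basis -> x ^ phi h = x.
Proof.
have n2 := dih_half.
have c0 := dih_c_gt0.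
have [k ltk [] ->] := dih_normal_form n_gt1 D2n x;
  have [i lti [] ->] := dih_normal_form n_gt1 D2n h.
- by rewrite dih_phiX conjgE -expgD addnC expgD mulKg.
- rewrite dih_phiXb (dih_rotJ_refl D2n) rot_in_basis //.
  rewrite (dih_rotV D2n (ltnW ltk)).
  have [-> _ _ | k0] := posnP k; first by apply/eqX; rewrite subn0 modnn mod0n.
  rewrite rot_in_basis; last by lia.
  by move=> nk nk'; congr (a ^+ _); lia.
- case/refl_notin_basis=> r le_r ->; rewrite dih_phiX.
  have [l el] := dih_reflJ_is_refl n_gt1 D2n (j0 + r) (a ^+ (s * i)%N).
  rewrite el => /refl_notin_basis[r' le_r' er']; move: el; rewrite er'.
  move/(dih_reflJ_rot D2n); rewrite (addnC (j0 + r')%N) mulnA.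
  rewrite (expgD _ (2 * s * i)%N) => /dih_coset_mod/eqP.
  by rewrite eqn_modDl !modn_small => [/eqP-> | |] //; lia.
- case/refl_notin_basis=> r le_r ->; rewrite dih_phiXb.
  have [l el] := dih_reflJ_is_refl n_gt1 D2n (j0 + r) (a ^+ (s * i + t)%N * b).
  rewrite el => /refl_notin_basis[r' le_r' er']; move: el; rewrite er'.
  move/(dih_reflJ_refl D2n); rewrite mulnDr mulnA.
  rewrite (expgD _ (2 * s * i)%N) => /dih_coset_mod.
  rewrite dih_double_t => /eqP.
  have ->: (j0 + r + (j0 + r') = 2 * j0 + (r + r'))%N by lia.
  rewrite -{2}(addn0 (2 * j0)%N) eqn_modDl mod0n => /dvdnP[q eq].
  by congr (a ^+ _ * b); case: q eq => [|[|q]]; rewrite ?mulSn; lia.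
Qed.

End DihedralTransversal.

(** * Bases and dimension *)

(** The dimension formula, 2n - (n/2 + c + 2), is doubled and freed of
    subtractions. *)
Lemma Inn_dihedral (F : fieldType) (gT : finGroupType) (n s t j0 M c : nat)
    (a b : gT) (phi : {morphism [set: gT] >-> gT}) :
  (1 < n)%N -> dihedral_presentation n a b ->
  phi a = (a ^+ s)%g -> phi b = (a ^+ t * b)%g -> t = j0 %[mod s] ->
  #[a ^+ (2 * s)]%g = M -> n = (M * (2 * c))%N ->
  let sigma : {lrmorphism galg F gT -> galg F gT} := galg_ext F phi in
  (2 * \dim (Inn sigma) + (n + 2 * c + 4) = 4 * n)%N /\
  basis_of (Inn sigma)
    [seq inn_lfun sigma (gelt g) | g <- enum (dih_basis n a b s j0 M c)].
Proof.
move=> n1 D2n phi_a phi_b t_mod oas n_eq sigma.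
have meet := dih_basis_meet n1 D2n oas n_eq phi_a phi_b t_mod.
have uniq := dih_basis_uniq n1 D2n oas n_eq phi_a phi_b t_mod.
split; last exact: basis_of_transversal meet uniq.
rewrite (dim_Inn_transversal F meet uniq).
have := dih_basis_card n1 D2n j0 oas n_eq; have := n_eq; rewrite mulnCA.
move: (M * c)%N #|_| => N K; lia.
Qed.

Theorem theorem5p12 (F : fieldType) (gT : finGroupType) (n s t j0 m d : nat)
    (a b : gT) (phi : {morphism [set: gT] >-> gT})
    (n_ge3 : (3 <= n)%N) (n_even : ~~ odd n)
    (D2n : dihedral_presentation n a b)
    (s_lt : (s <= n - 1)%N) (s_neq0 : s <> 0%N) (s_neq_half : s <> (n %/ 2)%N)
    (t_lt : (t <= n - 1)%N)
    (phi_a : phi a = (a ^+ s)%g) (phi_b : phi b = (a ^+ t * b)%g)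
    (m_def : m = #[phi a]%g) (d_def : d = (n %/ m)%N)
    (j0_lt : (j0 < s)%N) (t_mod : t = j0 %[mod s]) :
  let sigma1 : {lrmorphism galg F gT -> galg F gT} := galg_ext F phi in
  (odd m ->
     (\dim (Inn sigma1))%:R = (3%:R * n%:R - d%:R) / 2%:R - 2%:R :> rat
     /\ basis_of (Inn sigma1)
          [seq inn_lfun sigma1 (gelt g) | g <- enum (basis_odd a b n s j0 m d)])
  /\ (~~ odd m ->
     (\dim (Inn sigma1))%:R = (3%:R * n%:R) / 2%:R - d%:R - 2%:R :> rat
     /\ basis_of (Inn sigma1)
          [seq inn_lfun sigma1 (gelt g) | g <- enum (basis_even a b n s j0 m d)]).
Proof.
move=> sigma1.
have n1 : (1 < n)%N by lia.
have oa := (dih_order n1 D2n).1.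
have n_eq : n = (m * d)%N.
  by rewrite d_def mulnC divnK // m_def phi_a -oa orderXdvd.
(* gcd(m, 2) separates the two parts of the theorem. *)
have o2s : #[a ^+ (2 * s)]%g = (m %/ gcdn m 2)%N.
  by rewrite mulnC expgM orderXgcd -phi_a -m_def.
have dim_rat (D e : nat) : (2 * D + (n + e + 4) = 4 * n)%N ->
    D%:R = (3%:R * n%:R - e%:R) / 2%:R - 2%:R :> rat.
  move=> dimE; suff: 2%:R * D%:R + (n%:R + e%:R + 4%:R) = 4%:R * n%:R :> rat.
    by lra.
  by rewrite -!natrM -!natrD dimE.
split=> [m_odd | m_even].
  have d_even : d = (2 * d./2)%N.
    by move: n_even; rewrite n_eq oddM m_odd /= mul2n => /even_halfK.
  have oM : #[a ^+ (2 * s)]%g = m.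
    by rewrite o2s (eqP (_ : coprime m 2)) ?divn1 // coprimen2.
  have n_eq' : n = (m * (2 * d./2))%N by rewrite -d_even.
  have [dimE basis] := Inn_dihedral F n1 D2n phi_a phi_b t_mod oM n_eq'.
  by split=> //; apply: dim_rat; rewrite d_even.
have oM : #[a ^+ (2 * s)]%g = m./2.
  by rewrite o2s (gcdn_idPr _) ?divn2 // dvdn2.
have n_eq' : n = (m./2 * (2 * d))%N.
  by rewrite mulnA muln2 even_halfK.
have [dimE basis] := Inn_dihedral F n1 D2n phi_a phi_b t_mod oM n_eq'.
by split=> //; rewrite (dim_rat _ _ dimE) natrM; lra.
Qed.
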